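(* Let $I$ be a finite set with $|I|=n$. The linear map $\mathcal G:\mathbf M[I]\to\mathbb R[U_\alpha:\alpha\in\{0,1\}^n]$, $$\mathcal G(M)=\sum_{\ell}U_{\mathrm{rkjump}_M(\ell)},$$ summing over all linear orders $\ell=(\ell_1,\dots,\ell_n)$ of $I$, is a strong valuation on matroids: there is a linear map $\hat{\mathcal G}$ on the span of indicator functions of matroid polytopes of matroids on $I$ with $\mathcal G(M)=\hat{\mathcal G}(\mathbb 1_{P(M)})$ for every matroid $M$ on $I$.
   Context: A matroid $M$ on $I$ is a nonempty collection of subsets of $I$ (bases) satisfying the basis exchange axiom; its rank function is $\operatorname{rk}(J)=\max_B|J\cap B|$ over bases $B$. $\mathbf M[I]$ is the vector space with basis the matroids on $I$; $P(M)=\operatorname{conv}\{\sum_{b\in B}e_b: B\text{ a basis}\}$. For a linear order $\ell=(\ell_1,\dots,\ell_n)$ of $I$, $\mathrm{rkjump}_M(\ell)\in\{0,1\}^n$ has $i$-th entry $\operatorname{rk}(\{\ell_1,\dots,\ell_i\})-\operatorname{rk}(\{\ell_1,\dots,\ell_{i-1}\})$. The $U_\alpha$ are independent commuting variables indexed by $\{0,1\}^n$. *)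

(* Defs.v *)
From Stdlib Require Import ClassicalEpsilon.
From mathcomp Require Import all_boot all_order all_algebra.
From mathcomp Require Import mpoly.
Set Implicit Arguments. Unset Strict Implicit. Unset Printing Implicit Defensive.
Import Order.TTheory GRing.Theory Num.Theory.
Local Open Scope ring_scope.

Section Matroids.
Variable I : finType.

Definition is_matroid (bases : {set {set I}}) : Prop :=
  bases != set0 /\
  forall B1 B2, B1 \in bases -> B2 \in bases ->
    forall x, x \in B1 :\: B2 ->
      exists2 y, y \in B2 :\: B1 & (y |: (B1 :\ x)) \in bases.

Definition rk (bases : {set {set I}}) (J : {set I}) : nat :=
  \max_(B in bases) #|J :&: B|.

(* For a linear order l = (l_0, ..., l_{n-1}) of I (an injective map 'I_n -> I),
   the i-th entry of rkjump is rk{l_0..l_i} - rk{l_0..l_{i-1}} (which is 0 or 1),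
   encoded as a boolean (true = 1). *)
Definition rkjump (n : nat) (bases : {set {set I}}) (l : {ffun 'I_n -> I})
  : {ffun 'I_n -> bool} :=
  [ffun i : 'I_n =>
     (rk bases [set l j | j in [set j : 'I_n | (j <= i)%N]]
      - rk bases [set l j | j in [set j : 'I_n | (j < i)%N]] == 1)%N].

Definition Uvar (R : nzRingType) (n : nat) (a : {ffun 'I_n -> bool})
  : {mpoly R[#|{ffun 'I_n -> bool}|]} :=
  'X_(enum_rank a).

Definition Gval (R : nzRingType) (n : nat) (bases : {set {set I}})
  : {mpoly R[#|{ffun 'I_n -> bool}|]} :=
  \sum_(l : {ffun 'I_n -> I} | injectiveb l) Uvar R (rkjump bases l).

Definition in_polytope (R : realFieldType) (bases : {set {set I}})
  (x : I -> R) : Prop :=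
  exists lam : {set I} -> R,
    (forall B, 0 <= lam B) /\
    \sum_(B in bases) lam B = 1 /\
    forall i, x i = \sum_(B in bases) lam B * (i \in B)%:R.

Definition indicator_polytope (R : realFieldType) (bases : {set {set I}})
  : (I -> R) -> R :=
  fun x => if excluded_middle_informative (in_polytope bases x) then 1 else 0.

Definition in_indicator_span (R : realFieldType) (f : (I -> R) -> R) : Prop :=
  exists s : seq (R * {set {set I}}),
    (forall p, p \in s -> is_matroid p.2) /\
    forall x, f x = \sum_(p <- s) p.1 * indicator_polytope p.2 x.

End Matroids.

(* Main.v *)
Require Import Defs.
From Stdlib Require Import ClassicalEpsilon.
From mathcomp Require Import all_boot all_order all_algebra.
From mathcomp Require Import boolp.
From mathcomp Require Import mpoly lra zify.
Import Order.TTheory GRing.Theory Num.Theory.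
Local Open Scope ring_scope.

Set Implicit Arguments.
Unset Strict Implicit.
Unset Printing Implicit Defensive.

(** Let [J_0 <= ... <= J_n] be the flag of initial segments of a linear order.
    Some basis of a matroid meets every [J_i] in [rk J_i] elements, so the matroid
    polytope meets the region [x(J_i) >= r_i for all i] exactly when
    [rk J_i >= r_i] for all [i], and adding the inequality
    [sum_i x(J_i) >= sum_i r_i + 1] excludes exactly the case of equality
    everywhere. Hence the event that the rank vector along the flag is [r] is a
    difference of two functionals of the form "[P] meets the polyhedron [K]".
    Such a functional respects linear relations between indicator functions: it is
    the Euler characteristic of the intersection of [P] and [K], computed by
    projecting away one coordinate at a time. Fourier-Motzkin elimination keeps the
    projections polyhedral, so their fibres are closed intervals. On a line
    subdivided at all the end points, a nonempty closed interval is a path, which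
    has one more vertex than it has edges, and both vertices and edges can be
    counted by evaluating indicator functions at points. *)

(** * Linear relations *)

Lemma sum_fibers_eq0 (R : pzRingType) (V : lmodType R) (T W : eqType)
    (r : seq T) (c : T -> R) (g : T -> W) (F : W -> V) :
  (forall w, \sum_(k <- r) c k * (g k == w)%:R = 0) ->
  \sum_(k <- r) c k *: F (g k) = 0.
Proof.
move=> sum0; transitivity (\sum_(w <- undup (map g r))
    (\sum_(k <- r) c k * (g k == w)%:R) *: F w); last first.
  by apply: big1 => w _; rewrite sum0 scale0r.
under [RHS]eq_bigr do rewrite scaler_suml.
rewrite exchange_big /=; apply: eq_big_seq => k kr.
rewrite (bigD1_seq (g k)) ?undup_uniq ?mem_undup ?map_f //= eqxx mulr1.
by rewrite big1 ?addr0 // => w; rewrite eq_sym => /negPf->; rewrite mulr0 scale0r.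
Qed.

Section LinearExtension.
Variables (R : pzRingType) (X : Type) (T : eqType).
Variables (D : T -> Prop) (e : T -> X -> R).
Implicit Types (s : seq (R * T)) (f h : X -> R).

Definition represents s f : Prop :=
  (forall p, p \in s -> D p.2) /\ forall x, f x = \sum_(p <- s) p.1 * e p.2 x.

Definition lincomb (a : R) s (b : R) s' : seq (R * T) :=
  [seq (a * p.1, p.2) | p <- s] ++ [seq (b * p.1, p.2) | p <- s'].

Lemma sum_lincomb (V : lmodType R) a s b s' (F : T -> V) :
  \sum_(p <- lincomb a s b s') p.1 *: F p.2 =
  a *: (\sum_(p <- s) p.1 *: F p.2) + b *: (\sum_(p <- s') p.1 *: F p.2).
Proof.
rewrite big_cat !big_map !scaler_sumr.
by congr (_ + _); apply: eq_bigr => p _; rewrite scalerA.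
Qed.

Lemma represents_lincomb a s f b s' h : represents s f -> represents s' h ->
  represents (lincomb a s b s') (fun x => a * f x + b * h x).
Proof.
move=> [sD fE] [s'D hE]; split=> [p|x].
  by rewrite mem_cat => /orP[]/mapP[q]; [move/sD|move/s'D] => qD ->.
by rewrite fE hE; apply/esym/(sum_lincomb (V := R^o) a s b s' (fun t => e t x)).
Qed.

Lemma linear_extension (V : lmodType R) (g : T -> V) :
  (forall s, represents s (fun=> 0) -> \sum_(p <- s) p.1 *: g p.2 = 0) ->
  exists ghat : (X -> R) -> V,
    (forall f h a b, (exists s, represents s f) -> (exists s, represents s h) ->
       ghat (fun x => a * f x + b * h x) = a *: ghat f + b *: ghat h) /\
    (forall t, D t -> ghat (e t) = g t).
Proof.
move=> g0; pose eval s := \sum_(p <- s) p.1 *: g p.2.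
have eval_unique s s' f : represents s f -> represents s' f -> eval s = eval s'.
  move=> sf s'f; apply/eqP; rewrite -subr_eq0; apply/eqP.
  rewrite -[eval s]scale1r -[- eval s']scaleN1r -sum_lincomb; apply: g0.
  have := represents_lincomb 1 (-1) sf s'f.
  by under eq_fun do rewrite mul1r mulN1r subrr.
have [f|ghat ghatE] := @choice _ V (fun f v => forall s, represents s f -> v = eval s).
  have [[s sf]|no_rep] := pselect (exists s, represents s f).
    by exists (eval s) => s'; apply: eval_unique.
  by exists 0 => s sf; case: no_rep; exists s.
exists ghat; split=> [f h a b [s sf] [s' sh]|t tD].
  rewrite (ghatE _ _ (represents_lincomb a b sf sh)) (ghatE _ _ sf) (ghatE _ _ sh).
  exact: sum_lincomb.
rewrite (ghatE _ [:: (1, t)]); first by rewrite /eval big_seq1 scale1r.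
split=> [p|x]; first by rewrite inE => /eqP->.
by rewrite big_seq1 mul1r.
Qed.

End LinearExtension.

(** * The Euler relation on a line *)

Lemma sorted_zip_behead (d : Order.disp_t) (T : porderType d) (s : seq T) a b :
  sorted <=%O s -> (a, b) \in zip s (behead s) ->
  [/\ a \in s, (a <= b)%O & {in s, forall z, (z <= a)%O || (b <= z)%O}].
Proof.
elim: s => // x [//|y s] IHs xys.
have /allP x_min := le_path_min xys; have ys := path_sorted xys.
rewrite inE => /predU1P[[-> ->]|/(IHs ys)[a_ys ab gap]].
  split; rewrite ?mem_head ?x_min ?mem_head // => z.
  rewrite inE => /predU1P[->|]; first by rewrite lexx.
  by rewrite inE => /predU1P[->|/(allP (le_path_min ys))->]; rewrite ?lexx orbT.
split=> // [|z]; first by rewrite in_cons a_ys orbT.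
by rewrite inE => /predU1P[->|/gap//]; rewrite x_min.
Qed.

Lemma euler_path (R : pzRingType) (d : Order.disp_t) (T : porderType d)
    (F : pred T) (s : seq T) :
  (forall a t b, (a <= t <= b)%O -> F a -> F b -> F t) -> sorted <=%O s ->
  (has F s)%:R = \sum_(t <- s) (F t)%:R
    - \sum_(p <- zip s (behead s)) (F p.1 && F p.2)%:R :> R.
Proof.
move=> Fconv; elim: s => [|x [|y s] IHs] xys; first by rewrite !big_nil subr0.
  by rewrite big_seq1 big_nil subr0 /= orbF.
have ys := path_sorted xys; rewrite big_cons [in X in _ - X]big_cons /=.
rewrite opprD addrACA -(IHs ys) [_ || has _ _]/(has F (y :: s)).
have [Fx|] := boolP (F x); last by rewrite /= subr0 add0r.
suff FyE : F y = has F (y :: s) by rewrite orTb andTb FyE subrK.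
apply/idP/idP => [Fy|]; first by rewrite /= Fy.
case/hasP=> z zys Fz; apply: Fconv Fx Fz; have /andP[-> _] := xys.
by move: zys; rewrite inE => /predU1P[->|/(allP (le_path_min ys))->]; rewrite ?lexx.
Qed.

Section OneVariable.
Variable R : realFieldType.
Implicit Types (q : seq (R * R)) (p : R * R) (t : R).

Definition solves q t : bool := all (fun p => p.1 * t <= p.2) q.

(* A constraint with [p.1 = 0] contributes the harmless point [p.2 / 0 = 0]. *)
Definition breakpoints q : seq R := [seq p.2 / p.1 | p <- q].

Definition consistent q : bool :=
  all (fun p => 0 <= p.2) [seq p <- q | p.1 == 0] &&
  allrel (fun p p' => p'.1 * p.2 <= p.1 * p'.2)
    [seq p <- q | 0 < p.1] [seq p <- q | p.1 < 0].

Lemma separating_point (L U : seq R) : {in L & U, forall l u, l <= u} ->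
  exists2 t, t \in 0 :: L ++ U &
    {in L, forall l, l <= t} /\ {in U, forall u, t <= u}.
Proof.
elim: L => [_|l L IHL leLU].
  elim: U => [|u U [t tU0 [_ tU]]]; first by exists 0; rewrite ?mem_head.
  exists (Num.min u t).
    move: tU0; rewrite !inE; case: leP => _; first by rewrite eqxx orbT.
    by case/orP=> ->; rewrite ?orbT.
  split=> // v; rewrite inE => /predU1P[->|/tU tv]; first by rewrite ge_min lexx.
  by rewrite ge_min tv orbT.
have [l' u lL uU|t t0 [Lt tU]] := IHL; first by apply: leLU; rewrite // inE lL orbT.
exists (Num.max l t).
  move: t0; rewrite !inE; case: leP => _; last by rewrite eqxx orbT.
  by case/orP=> ->; rewrite ?orbT.
split=> v; last by move=> vU; rewrite ge_max tU // leLU ?mem_head.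
by rewrite inE le_max => /predU1P[->|/Lt->]; rewrite ?lexx ?orbT.
Qed.

Lemma solves_consistent q t : solves q t -> consistent q.
Proof.
move=> /allP qt; apply/andP; split.
  by apply/allP=> p; rewrite mem_filter => /andP[/eqP p0 /qt]; rewrite p0 mul0r.
apply/allrelP=> p p'; rewrite !mem_filter => /andP[p_gt0 /qt pt] /andP[p'_lt0 /qt p't].
apply: (@le_trans _ _ (p.1 * p'.1 * t)); first by rewrite -mulrA mulrCA ler_nM2l.
by rewrite -mulrA ler_pM2l.
Qed.

Lemma consistent_breakpoint q : consistent q -> has (solves q) (0 :: breakpoints q).
Proof.
move=> /andP[/allP q0 /allrelP qpn].
have [l u|t tq [Lt tU]] := @separating_point
    [seq p.2 / p.1 | p <- q & p.1 < 0] [seq p.2 / p.1 | p <- q & 0 < p.1].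
  move=> /mapP[p' + ->] /mapP[p + ->] => p'q pq.
  have := qpn _ _ pq p'q; move: p'q pq; rewrite !mem_filter.
  move=> /andP[p'_lt0 _] /andP[p_gt0 _] pp'.
  by rewrite ler_pdivlMr // mulrAC ler_ndivrMr // [leLHS]mulrC [leRHS]mulrC.
apply/hasP; exists t.
  move: tq; rewrite !inE mem_cat; case: eqP => //= _.
  by case/orP=> /mapP[p]; rewrite mem_filter => /andP[_ pq] ->; apply: map_f.
apply/allP=> p pq; case: (ltgtP p.1 0) => p0.
- by rewrite mulrC -ler_ndivrMr // Lt //; apply/mapP; exists p; rewrite ?mem_filter ?p0.
- by rewrite mulrC -ler_pdivlMr // tU //; apply/mapP; exists p; rewrite ?mem_filter ?p0.
- by rewrite p0 mul0r q0 // mem_filter p0 eqxx.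
Qed.

Lemma solves_convex q a t b : a <= t <= b -> solves q a -> solves q b -> solves q t.
Proof.
move=> /andP[le_at le_tb] /allP qa /allP qb; apply/allP=> p pq.
have [p0|p0] := lerP 0 p.1.
  by apply: le_trans (qb p pq); rewrite ler_wpM2l.
by apply: le_trans (qa p pq); rewrite ler_nM2l.
Qed.

Lemma solves_midpoint q a b :
  a <= b -> {in breakpoints q, forall z, (z <= a) || (b <= z)} ->
  solves q ((a + b) / 2) = solves q a && solves q b.
Proof.
move=> ab gap; rewrite /solves -all_predI; apply: eq_in_all => p pq /=.
have := gap _ (map_f _ pq); move: (p.1) (p.2) => u v.
have [u0|u0|->] := ltgtP u 0; last by rewrite !mul0r andbb.
  have uE t : (u * t <= v) = (v / u <= t) by rewrite mulrC ler_ndivrMr.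
  by rewrite !uE => /orP[]?; apply/idP/andP=> [|[]]; lra.
have uE t : (u * t <= v) = (t <= v / u) by rewrite mulrC ler_pdivlMr.
by rewrite !uE => /orP[]?; apply/idP/andP=> [|[]]; lra.
Qed.

Lemma euler_line (T : eqType) (r : seq T) (c : T -> R) (q : T -> seq (R * R)) :
  (forall t, \sum_(k <- r) c k * (solves (q k) t)%:R = 0) ->
  \sum_(k <- r) c k * (consistent (q k))%:R = 0.
Proof.
move=> sum0.
pose v := sort <=%O (0 :: flatten [seq breakpoints (q k) | k <- r]).
have vE k : k \in r -> {subset 0 :: breakpoints (q k) <= v}.
  move=> kr z; rewrite mem_sort !inE => /predU1P[->|zk]; first by rewrite eqxx.
  by apply/orP; right; apply/flatten_mapP; exists k.
transitivity (\sum_(t <- v) \sum_(k <- r) c k * (solves (q k) t)%:R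
    - \sum_(p <- zip v (behead v))
        \sum_(k <- r) c k * (solves (q k) ((p.1 + p.2) / 2))%:R); last first.
  by rewrite !big1 ?subrr.
rewrite exchange_big [in X in _ - X]exchange_big -sumrB /=.
apply: eq_big_seq => k kr; rewrite -!mulr_sumr -mulrBr; congr (_ * _).
have -> : consistent (q k) = has (solves (q k)) v.
  apply/idP/hasP=> [/consistent_breakpoint/hasP[t tk qt]|[t _ /solves_consistent//]].
  by exists t => //; apply: vE tk.
rewrite (euler_path R (@solves_convex (q k)) (sort_le_sorted _)); congr (_ - _).
apply: eq_big_seq => -[a b] /(sorted_zip_behead (sort_le_sorted _))[_ ab gap].
rewrite solves_midpoint // => z zk; apply: gap; apply: vE kr _ _.
by rewrite inE zk orbT.
Qed.

End OneVariable.

(** * Polyhedra *)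

Section Polyhedron.
Variables (R : realFieldType) (J : finType).
Implicit Types (x : J -> R) (j : J).

Local Notation constraint := ({ffun J -> R} * R)%type.
Implicit Types (s : seq constraint) (p : constraint).

Definition polyhedron s x : bool := all (fun p => \sum_j p.1 j * x j <= p.2) s.

Definition fiber s j x : seq (R * R) :=
  [seq (p.1 j, p.2 - \sum_(k | k != j) p.1 k * x k) | p : constraint <- s].

Definition cancel_coord j p p' : constraint :=
  ([ffun k => p.1 j * p'.1 k - p'.1 j * p.1 k], p.1 j * p'.2 - p'.1 j * p.2).

Definition fourier_motzkin j s : seq constraint :=
  [seq p : constraint <- s | p.1 j == 0] ++
  [seq cancel_coord j p p' | p <- [seq p : constraint <- s | 0 < p.1 j],
                             p' <- [seq p : constraint <- s | p.1 j < 0]].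

Lemma polyhedron_fiber s j x t :
  polyhedron s [eta x with j |-> t] = solves (fiber s j x) t.
Proof.
rewrite /solves all_map; apply: eq_all => p /=.
rewrite (bigD1 j) //= eqxx lerBrDr; congr (_ + _ <= _).
by apply: eq_bigr => k /negPf->.
Qed.

Lemma polyhedron_fourier_motzkin s j x :
  polyhedron (fourier_motzkin j s) x = consistent (fiber s j x).
Proof.
have sumE p : \sum_k p.1 k * x k = p.1 j * x j + \sum_(k | k != j) p.1 k * x k.
  by rewrite (bigD1 j).
rewrite /polyhedron /consistent all_cat !filter_map all_map allrel_mapl allrel_mapr.
congr (_ && _).
  apply: eq_in_all => p; rewrite mem_filter /= => /andP[/eqP p0 _].
  by rewrite sumE p0 mul0r add0r subr_ge0.
have cancelE p p' : \sum_k (cancel_coord j p p').1 k * x k =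
    p.1 j * (\sum_(k | k != j) p'.1 k * x k) - p'.1 j * (\sum_(k | k != j) p.1 k * x k).
  rewrite sumE ffunE [p'.1 j * _]mulrC subrr mul0r add0r !mulr_sumr -sumrB.
  by apply: eq_bigr => k _; rewrite ffunE mulrBl !mulrA.
apply/all_allpairsP/allrelP=> pp' p p' ps p's; have := pp' p p' ps p's;
  rewrite cancelE /= !mulrBr; lra.
Qed.

Lemma fourier_motzkinP s j x :
  polyhedron (fourier_motzkin j s) x <-> exists t, polyhedron s [eta x with j |-> t].
Proof.
rewrite polyhedron_fourier_motzkin; split=> [/consistent_breakpoint/hasP[t _ qt]|[t]].
  by exists t; rewrite polyhedron_fiber.
by rewrite polyhedron_fiber => /solves_consistent.
Qed.

(* Projections are kept as cylinders over the remaining coordinates, so that the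
   index type never changes. *)
Lemma fourier_motzkin_seqP s js x :
  polyhedron (foldr fourier_motzkin s js) x <->
  exists2 z, {in [predC js], z =1 x} & polyhedron s z.
Proof.
elim: js x => [|j js IHjs] x /=.
  by split=> [xs|[z zx]]; [exists x | have -> : z = x by apply/funext => k; apply: zx].
rewrite fourier_motzkinP; split=> [[t /IHjs[z zx zs]]|[z zx zs]].
  exists z => // k; rewrite !inE negb_or => /andP[/negPf kj kjs].
  by rewrite zx //= kj.
exists (z j); apply/IHjs; exists z => // k kjs /=.
by have [->//|kj] := eqVneq k j; apply: zx; rewrite !inE negb_or kj.
Qed.

Lemma euler_projection (T : eqType) (r : seq T) (c : T -> R) (s : T -> seq constraint)
    (js : seq J) :
  (forall x, \sum_(k <- r) c k * (polyhedron (s k) x)%:R = 0) ->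
  forall x, \sum_(k <- r) c k * (polyhedron (foldr fourier_motzkin (s k) js) x)%:R = 0.
Proof.
move=> sum0; elim: js => [//|j js IHjs] x /=.
under eq_bigr do rewrite polyhedron_fourier_motzkin; apply: euler_line => t.
by under eq_bigr do rewrite -polyhedron_fiber; apply: IHjs.
Qed.

Definition polyhedral (S : (J -> R) -> Prop) : Prop :=
  exists s, forall x, S x <-> polyhedron s x.

Lemma euler_polyhedral (T : eqType) (r : seq T) (c : T -> R)
    (S : T -> (J -> R) -> Prop) :
  (forall k, polyhedral (S k)) ->
  (forall x, \sum_(k <- r) c k * `[< S k x >]%:R = 0) ->
  \sum_(k <- r) c k * `[< exists x, S k x >]%:R = 0.
Proof.
move=> /choice[s sE] sum0.
have S0 x : \sum_(k <- r) c k * (polyhedron (s k) x)%:R = 0.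
  by rewrite -[RHS](sum0 x); under [RHS]eq_bigr do rewrite (propext (sE _ _)) asboolb.
rewrite -[RHS](euler_projection (enum J) S0 (fun=> 0)).
apply: eq_bigr => k _; rewrite -[polyhedron _ _]asboolb; congr (_ * (nat_of_bool _)%:R).
apply: asbool_equiv_eq.
rewrite fourier_motzkin_seqP; split=> [[x /sE xs]|[x _ /sE]]; last by exists x.
by exists x => // j; rewrite !inE mem_enum.
Qed.

Definition affine (f : (J -> R) -> R) : Prop :=
  exists (a : {ffun J -> R}) (b : R), forall x, f x = \sum_j a j * x j + b.

Lemma affine_cst b : affine (fun=> b).
Proof.
by exists [ffun=> 0], b => x; rewrite big1 ?add0r // => j _; rewrite ffunE mul0r.
Qed.

Lemma affine_coord j : affine (fun x => x j).
Proof.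
exists [ffun k => (k == j)%:R], 0 => x; rewrite (bigD1 j) //= ffunE eqxx mul1r.
by rewrite big1 ?addr0 // => k /negPf kj; rewrite ffunE kj mul0r.
Qed.

Lemma affineD f g : affine f -> affine g -> affine (fun x => f x + g x).
Proof.
move=> [a [b fE]] [a' [b' gE]]; exists [ffun k => a k + a' k], (b + b') => x.
rewrite fE gE addrACA -big_split; congr (_ + _).
by apply: eq_bigr => k _; rewrite ffunE mulrDl.
Qed.

Lemma affineMr u f : affine f -> affine (fun x => f x * u).
Proof.
move=> [a [b fE]]; exists [ffun k => a k * u], (b * u) => x.
rewrite fE mulrDl mulr_suml; congr (_ + _).
by apply: eq_bigr => k _; rewrite ffunE mulrAC.
Qed.

Lemma affine_sum (K : Type) (r : seq K) (P : pred K) (F : K -> (J -> R) -> R) :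
  (forall k, affine (F k)) -> affine (fun x => \sum_(k <- r | P k) F k x).
Proof.
move=> Faff; elim: r => [|k r IHr].
  by under eq_fun do rewrite big_nil; apply: affine_cst.
under eq_fun do rewrite big_cons; case: (P k) => //.
exact: affineD (Faff k) IHr.
Qed.

Lemma polyhedralI S S' :
  polyhedral S -> polyhedral S' -> polyhedral (fun x => S x /\ S' x).
Proof.
move=> [s sE] [s' sE']; exists (s ++ s') => x.
by rewrite sE sE' /polyhedron all_cat; apply: rwP andP.
Qed.

Lemma polyhedral_le f g : affine f -> affine g -> polyhedral (fun x => f x <= g x).
Proof.
move=> [a [b fE]] [a' [b' gE]]; exists [:: ([ffun k => a k - a' k], b' - b)] => x.
rewrite /polyhedron /= andbT fE gE.
under [in X in _ <-> is_true X]eq_bigr do rewrite ffunE mulrBl.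
by rewrite sumrB; split; lra.
Qed.

Lemma polyhedral_eq f g : affine f -> affine g -> polyhedral (fun x => f x = g x).
Proof.
move=> faff gaff.
have [s sE] := polyhedralI (polyhedral_le faff gaff) (polyhedral_le gaff faff).
exists s => x; rewrite -sE; split=> [->//|[fg gf]].
by apply/le_anti; rewrite fg gf.
Qed.

Lemma polyhedral_forall (K : finType) (S : K -> (J -> R) -> Prop) :
  (forall k, polyhedral (S k)) -> polyhedral (fun x => forall k, S k x).
Proof.
move=> /choice[s sE]; exists (flatten [seq s k | k <- enum K]) => x.
split=> [xS|/allP xs k].
  by apply/allP=> p /flatten_mapP[k _ pk]; have /sE/allP/(_ p pk) := xS k.
by apply/sE/allP=> p pk; apply/xs/flatten_mapP; exists k; rewrite ?mem_enum.
Qed.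

End Polyhedron.

Section Projection.
Variables (R : realFieldType) (J K : finType).

Definition join_coords (x : J -> R) (y : K -> R) (i : J + K) : R :=
  match i with inl j => x j | inr k => y k end.

Lemma polyhedral_ex (S : (J + K -> R) -> Prop) :
  polyhedral S -> polyhedral (fun x => exists y, S (join_coords x y)).
Proof.
move=> [s sE]; pose s' := foldr (@fourier_motzkin R _) s (map inr (enum K)).
exists [seq ([ffun j => p.1 (inl j)], p.2) | p : {ffun J + K -> R} * R <- s'] => x.
have restrictE (a : {ffun J + K -> R}) :
    \sum_i a i * join_coords x (fun=> 0) i = \sum_j [ffun j => a (inl j)] j * x j.
  rewrite big_sumType /= [X in _ + X]big1 ?addr0 => [|k _]; last by rewrite mulr0.
  by apply: eq_bigr => j _; rewrite ffunE.
transitivity (polyhedron s' (join_coords x (fun=> 0))); last first.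
  by rewrite /polyhedron all_map; under eq_all do rewrite restrictE.
rewrite fourier_motzkin_seqP; split=> [[y /sE xys]|[z zx /sE zS]].
  exists (join_coords x y) => // -[j|k] //.
  by rewrite !inE map_f // mem_enum.
exists (fun k => z (inr k)); suff <- : z = join_coords x (fun k => z (inr k)) by [].
by apply/funext=> -[j|k] //=; apply: zx; rewrite !inE; apply/mapP=> -[].
Qed.

End Projection.

(** * Bases of matroids *)

Section Bases.
Variables (I : finType) (bases : {set {set I}}).
Hypothesis bases_matroid : is_matroid bases.
Implicit Types (A B J : {set I}).

Lemma sum_mem_card A B : (\sum_(x in A) (x \in B) = #|A :&: B|)%N.
Proof. by rewrite -big_mkcondr /= sum1dep_card; apply: eq_card => x; rewrite !inE. Qed.

Lemma cardsI_exchange J B x y : x \in B -> y \notin B ->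
  (#|(y |: (B :\ x)) :&: J| + (x \in J) = #|B :&: J| + (y \in J))%N.
Proof.
move=> xB yB; rewrite -!sum_mem_card big_setU1 ?inE ?(negPf yB) ?andbF //=.
by rewrite [in RHS](big_setD1 x) //=; lia.
Qed.

Lemma cards_exchange B x y : x \in B -> y \notin B -> #|y |: (B :\ x)| = #|B|.
Proof.
move=> xB yB; have := cardsI_exchange setT xB yB.
by rewrite !setIT !inE => /addIn.
Qed.

Lemma cardsD_exchange B B' x y : x \in B :\: B' -> y \in B' :\: B ->
  (#|(y |: (B :\ x)) :\: B'| < #|B :\: B'|)%N.
Proof.
rewrite !inE => /andP[xB' xB] /andP[yB yB'].
have := cardsI_exchange (~: B') xB yB.
by rewrite -!setDE !inE xB' yB' addn0 addn1 => <-.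
Qed.

Lemma basis_exchange B B' x : B \in bases -> B' \in bases -> x \in B :\: B' ->
  exists2 y, y \in B' :\: B & (y |: (B :\ x)) \in bases.
Proof. by move=> Bb B'b; apply: bases_matroid.2. Qed.

Lemma leq_rk J B : B \in bases -> (#|J :&: B| <= rk bases J)%N.
Proof. by move=> Bb; apply: (@leq_bigmax_cond _ (mem bases) (fun C => #|J :&: C|)). Qed.

Lemma rk_attained J : exists2 B, B \in bases & rk bases J = #|J :&: B|.
Proof.
have card0 : (0 < #|bases|)%N by rewrite card_gt0 bases_matroid.1.
have [B Bb rkE] := @eq_bigmax_cond _ (mem bases) (fun C => #|J :&: C|) card0.
by exists B.
Qed.

Lemma leq_card_basis B B' : B \in bases -> B' \in bases -> (#|B| <= #|B'|)%N.
Proof.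
move=> + B'b; have [m] := ubnP #|B :\: B'|; elim: m B => // m IHm B lt_m Bb.
have [/subset_leq_card//|/subsetPn[x xB xB']] := boolP (B \subset B').
have xD : x \in B :\: B' by rewrite inE xB' xB.
have [y yD Cb] := basis_exchange Bb B'b xD.
have yB : y \notin B by move: yD; rewrite inE => /andP[].
rewrite -(cards_exchange xB yB); apply: IHm => //.
exact: leq_trans (cardsD_exchange xD yD) lt_m.
Qed.

Lemma card_basis B B' : B \in bases -> B' \in bases -> #|B| = #|B'|.
Proof. by move=> Bb B'b; apply/eqP; rewrite eqn_leq !leq_card_basis. Qed.

(* Among the bases meeting [J] in more elements than [B] does, one with
   [B' :\: B] smallest has [B' :\: B] inside [J]. *)
Lemma basis_exchange_into J B B' : B \in bases -> B' \in bases ->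
  (#|B :&: J| < #|B' :&: J|)%N ->
  exists x y, [/\ x \in B :\: J, y \in J :\: B & (y |: (B :\ x)) \in bases].
Proof.
move=> Bb B'b ltJ.
pose better C := (C \in bases) && (#|B :&: J| < #|C :&: J|)%N.
have {B'b ltJ} : better B' by rewrite /better B'b.
case/(arg_minnP (fun C => #|C :\: B|)) => {}B' /andP[B'b ltJ] B'min.
have sJ : B' :\: B \subset J.
  apply/subsetP=> z zD; apply: contraT => zJ.
  have [y yD Cb] := basis_exchange B'b Bb zD.
  have [zB' yB'] : z \in B' /\ y \notin B'.
    by move: zD yD; rewrite !inE => /andP[_ ->] /andP[->].
  have := B'min (y |: (B' :\ z)); rewrite leqNgt cardsD_exchange //; apply.
  rewrite /better Cb; have := cardsI_exchange J zB' yB'.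
  by rewrite (negPf zJ); lia.
have [x xD] : exists x, x \in B :\: J :\: B'.
  apply/set0Pn; rewrite setD_eq0; apply/negP => sBB'.
  have : (#|B :\: J| <= #|B' :\: J|)%N.
    apply/subset_leq_card/subsetP=> z zD; have := subsetP sBB' z zD.
    by move: zD; rewrite !inE => /andP[->].
  by move: (card_basis Bb B'b) ltJ; rewrite -(cardsID J B) -(cardsID J B'); lia.
move: xD; rewrite !inE => /and3P[xB' xJ xB].
have [|y yD Cb] := @basis_exchange B B' x Bb B'b; first by rewrite inE xB' xB.
exists x, y; rewrite !inE xJ xB (subsetP sJ y yD) Cb.
by move: yD; rewrite inE => /andP[->].
Qed.

(* A basis maximising the sum of the intersection sizes is optimal for every
   member of the flag: moving an element into [J k] decreases no other term. *)
Lemma flag_basis m (J : 'I_m -> {set I}) :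
  {homo J : i j / (i <= j)%N >-> i \subset j} ->
  exists2 B, B \in bases & forall i, rk bases (J i) = #|J i :&: B|.
Proof.
move=> Jmono; have [B0 B0b] := set0Pn _ bases_matroid.1.
have [B Bb Bmax] := arg_maxnP (fun B => \sum_i #|B :&: J i|)%N B0b.
exists B => // k; apply/eqP; rewrite eqn_leq leq_rk // andbT.
rewrite leqNgt; apply/negP=> lt_k; have [B' B'b rkE] := rk_attained (J k).
move: lt_k; rewrite rkE ![J k :&: _]setIC => /(basis_exchange_into Bb B'b)[x [y []]].
rewrite !inE => /andP[xJ xB] /andP[yB yJ] Cb.
have xy_le i : ((x \in J i) + (i == k) <= (y \in J i))%N.
  have [ki|ik] := leqP k i.
    rewrite (subsetP (Jmono _ _ ki) y yJ); have [->|_] := eqVneq i k.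
      by rewrite (negPf xJ).
    by rewrite addn0 leq_b1.
  rewrite (negPf (contra (subsetP (Jmono _ _ (ltnW ik)) x) xJ)).
  by rewrite -val_eqE /= ltn_eqF.
have : (\sum_i (x \in J i) < \sum_i (y \in J i))%N.
  apply: (@leq_trans (\sum_i ((x \in J i) + (i == k)))%N); last exact: leq_sum.
  by rewrite big_split /= (bigD1 k (F := fun i => nat_of_bool (i == k))) //= eqxx; lia.
have := Bmax _ Cb; have : (\sum_i (#|(y |: (B :\ x)) :&: J i| + (x \in J i)) =
    \sum_i (#|B :&: J i| + (y \in J i)))%N.
  by apply: eq_bigr => i _; apply: cardsI_exchange.
by rewrite !big_split /=; lia.
Qed.

End Bases.

(** * Matroid polytopes *)

Lemma eq_ffun_leq_sum (K : finType) (r v : {ffun K -> nat}) :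
  (forall i, r i <= v i)%N -> (v == r) = (\sum_i v i <= \sum_i r i)%N.
Proof.
move=> rv; have [_ sumE] := leqif_sum (fun i (_ : true) => leqif_eq (rv i)).
rewrite leq_eqVlt ltnNge leq_sum // orbF eq_sym [RHS]eq_sym sumE.
apply/eqP/forallP=> [-> i|rE]; first exact: eqxx.
by apply/ffunP=> i; apply/eqP/rE.
Qed.

Section MatroidPolytopes.
Variables (R : realFieldType) (I : finType).
Implicit Types (bases : {set {set I}}) (s : seq (R * {set {set I}})) (x : I -> R).

Lemma indicator_polytopeE bases x :
  indicator_polytope bases x = `[< in_polytope bases x >]%:R.
Proof.
rewrite /indicator_polytope; case: excluded_middle_informative => xP.
  by rewrite asboolT.
by rewrite asboolF.
Qed.

Lemma polyhedral_in_polytope bases : polyhedral (@in_polytope I R bases).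
Proof.
apply: (@polyhedral_ex R I {set I} (fun z => (forall B, 0 <= z (inr B)) /\
  (\sum_(B in bases) z (inr B) = 1 /\
   forall i, z (inl i) = \sum_(B in bases) z (inr B) * (i \in B)%:R))).
apply: polyhedralI; last apply: polyhedralI.
- apply: polyhedral_forall => B.
  by apply: polyhedral_le; [apply: affine_cst | apply: affine_coord].
- apply: polyhedral_eq; last exact: affine_cst.
  by apply: affine_sum => B; apply: affine_coord.
- apply: polyhedral_forall => i; apply: polyhedral_eq; first exact: affine_coord.
  by apply: affine_sum => B; apply/affineMr/affine_coord.
Qed.

Lemma in_polytope_basis bases B :
  B \in bases -> in_polytope bases (fun i => (i \in B)%:R : R).
Proof.
move=> Bb; exists (fun C => (C == B)%:R).
have sumE (F : {set I} -> R) : \sum_(C in bases) (C == B)%:R * F C = F B.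
  rewrite (bigD1 B) //= eqxx mul1r big1 ?addr0 // => C /andP[_ /negPf->].
  by rewrite mul0r.
split=> [C|]; first exact: ler0n.
split=> [|i]; last by rewrite sumE.
by under eq_bigr do rewrite -[_%:R]mulr1; rewrite sumE.
Qed.

Lemma in_polytope_le_rk bases x (A : {set I}) :
  in_polytope bases x -> \sum_(i in A) x i <= (rk bases A)%:R.
Proof.
move=> [lam [lam0 [lam1 xE]]].
under eq_bigr do rewrite xE.
rewrite exchange_big /= -[leRHS]mul1r -[X in _ <= X * _]lam1 mulr_suml.
apply: ler_sum => B Bb; rewrite -mulr_sumr ler_wpM2l // -natr_sum ler_nat.
by rewrite sum_mem_card leq_rk.
Qed.

Definition indicator_relation s : Prop :=
  represents (@is_matroid I) (@indicator_polytope I R) s (fun=> 0).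

Lemma meets_polyhedron_valuation s (K : (I -> R) -> Prop) :
  indicator_relation s -> polyhedral K ->
  \sum_(p <- s) p.1 * `[< exists x, in_polytope p.2 x /\ K x >]%:R = 0.
Proof.
move=> [_ sum0] Kpol.
apply: (euler_polyhedral (S := fun p x => in_polytope p.2 x /\ K x)) => [p|x].
  exact: polyhedralI (polyhedral_in_polytope _) Kpol.
under eq_bigr do rewrite asbool_and -mulnb natrM mulrA -indicator_polytopeE.
by rewrite -mulr_suml -sum0 mul0r.
Qed.

Section Flag.
Variables (m : nat) (J : 'I_m -> {set I}).
Hypothesis J_mono : {homo J : i j / (i <= j)%N >-> i \subset j}.
Implicit Types (r : 'I_m -> nat) (t : nat).

Definition flag_region r t x : Prop :=
  (forall i, (r i)%:R <= \sum_(e in J i) x e) /\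
  t%:R <= \sum_i \sum_(e in J i) x e.

Lemma polyhedral_flag_region r t : polyhedral (flag_region r t).
Proof.
have J_affine i : affine (fun x => \sum_(e in J i) x e).
  by apply: affine_sum => e; apply: affine_coord.
apply: polyhedralI.
  by apply: polyhedral_forall => i; apply: polyhedral_le (affine_cst _ _) (J_affine i).
by apply: polyhedral_le (affine_cst _ _) _; apply: affine_sum.
Qed.

Lemma meets_flag_regionP bases r t : is_matroid bases ->
  reflect (exists x, in_polytope bases x /\ flag_region r t x)
    ([forall i, r i <= rk bases (J i)] && (t <= \sum_i rk bases (J i)))%N.
Proof.
move=> bm; apply: (iffP andP) => [[/forallP rJ tJ]|[x [xP [xr xt]]]].
  have [B Bb BE] := flag_basis bm J_mono.
  have sumE i : \sum_(e in J i) (e \in B)%:R = (rk bases (J i))%:R :> R.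
    by rewrite -natr_sum sum_mem_card BE.
  exists (fun e => (e \in B)%:R); split; first exact: in_polytope_basis.
  split=> [i|]; first by rewrite sumE ler_nat.
  by under eq_bigr do rewrite sumE; rewrite -natr_sum ler_nat.
split; first apply/forallP=> i; rewrite -(ler_nat R).
  exact: le_trans (in_polytope_le_rk _ xP).
rewrite natr_sum; apply: (le_trans xt); apply: ler_sum => i _.
exact: in_polytope_le_rk.
Qed.

End Flag.

Lemma flag_rank_valuation m (J : 'I_m -> {set I}) s (r : {ffun 'I_m -> nat}) :
  {homo J : i j / (i <= j)%N >-> i \subset j} -> indicator_relation s ->
  \sum_(p <- s) p.1 * ([ffun i => rk p.2 (J i)] == r)%:R = 0.
Proof.
move=> J_mono srel.
have meets0 t := meets_polyhedron_valuation srel (polyhedral_flag_region J r t).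
rewrite -[RHS](subrr (0 : R)) -[X in _ = X - _](meets0 0%N).
rewrite -[X in _ = _ - X](meets0 (\sum_i r i).+1) -sumrB.
apply: eq_big_seq => p ps; rewrite -mulrBr; congr (_ * _).
rewrite !(sameP (asboolP _) (meets_flag_regionP J_mono _ _ (srel.1 p ps))) /= andbT.
set v := finfun _; have vE i : rk p.2 (J i) = v i by rewrite ffunE.
rewrite (eq_bigr _ (fun i _ => vE i)); under eq_forallb do rewrite vE.
have [/forallP rv|] := boolP [forall i, r i <= v i]%N.
  by rewrite eq_ffun_leq_sum // leqNgt; case: ltnP => _; rewrite ?subrr ?subr0.
rewrite subrr; apply: contraNeq; rewrite pnatr_eq0 eqb0 negbK => /eqP->.
exact/forallP.
Qed.

Definition initial_segment n (l : {ffun 'I_n -> I}) (i : 'I_n.+1) : {set I} :=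
  [set l j | j in [set j : 'I_n | (j < i)%N]].

Lemma initial_segment_mono n (l : {ffun 'I_n -> I}) :
  {homo initial_segment l : i j / (i <= j)%N >-> i \subset j}.
Proof.
move=> i j ij; apply: imsetS; apply/subsetP=> k; rewrite !inE => ki.
exact: leq_trans ij.
Qed.

Definition jumps n (v : {ffun 'I_n.+1 -> nat}) : {ffun 'I_n -> bool} :=
  [ffun i : 'I_n => (v (lift ord0 i) - v (widen_ord (leqnSn n) i) == 1)%N].

Lemma rkjumpE n bases (l : {ffun 'I_n -> I}) :
  rkjump bases l = jumps [ffun i => rk bases (initial_segment l i)].
Proof. by apply/ffunP=> i; rewrite !ffunE. Qed.

Lemma Gval_valuation n s :
  indicator_relation s -> \sum_(p <- s) p.1 *: Gval R n p.2 = 0.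
Proof.
move=> srel; under eq_bigr do rewrite scaler_sumr.
rewrite exchange_big /=; apply: big1 => l _.
under eq_bigr do rewrite rkjumpE.
apply: (sum_fibers_eq0 (g := fun p => [ffun i => rk p.2 (initial_segment l i)])
                       (fun v => Uvar R (jumps v))) => v.
exact: flag_rank_valuation (@initial_segment_mono n l) srel.
Qed.

End MatroidPolytopes.

Theorem theorem7p9 (R : realFieldType) (I : finType) (n : nat)
  (hI : #|I| = n) :
  exists Ghat : ((I -> R) -> R) -> {mpoly R[#|{ffun 'I_n -> bool}|]},
    (forall (f g : (I -> R) -> R) (a b : R),
       in_indicator_span f -> in_indicator_span g ->
       Ghat (fun x => a * f x + b * g x) = a *: Ghat f + b *: Ghat g) /\
    (forall bases : {set {set I}}, is_matroid bases ->
       Gval R n bases = Ghat (indicator_polytope bases)).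
Proof.
have [Ghat [Ghat_lin GhatE]] := linear_extension (@Gval_valuation R I n).
by exists Ghat; split=> [|bases bm]; [exact: Ghat_lin | rewrite GhatE].
Qed.
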